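(* Every $(l,S_j)$-inequality can be obtained as a projected inequality. That is, for every $i_0\in I$, every $l\in T$ with $L=\{1,\ldots,l\}$, and every choice of sets $S_j\subseteq L$ ($j\in J$), there is a projection vector $(\theta,\gamma,\phi)$ whose projected inequality $$\sum_{i=1}^{NI}\sum_{j=1}^{NJ}\sum_{t=1}^{NT}\theta^{ij}_tx^{ij}_t+\sum_{i=1}^{NI}\sum_{j=1}^{NJ}\sum_{t=1}^{NT}\sum_{k=t}^{NT}\gamma^{ij}_{tk}d^i_ky^j_t+\sum_{i=1}^{NI}\sum_{t=1}^{NT}\phi^i_td^i_t\ge 0$$ is, as a linear inequality in $(x,y)$, the same as the $(l,S_j)$-inequality $$\sum_{j=1}^{NJ}\Big(\sum_{u\in L\setminus S_j}x^{i_0j}_u+\sum_{u\in S_j}d^{i_0}_{ul}\,y^j_u\Big)\ge d^{i_0}_{1l}$$ (up to moving the constant term to the other side).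
   Context: Data: items $I=\{1,\ldots,NI\}$, suppliers $J=\{1,\ldots,NJ\}$, periods $T=\{1,\ldots,NT\}$, demands $d^i_t\ge 0$; $d^i_{kt}=\sum_{l=k}^td^i_l$ for $k\le t$. The inequalities are in variables $x^{ij}_t$ ($i\in I,j\in J,t\in T$) and $y^j_t$ ($j\in J,t\in T$). A projection vector is a real vector $(\theta,\gamma,\phi)$, with components $\theta^{ij}_t$, $\gamma^{ij}_{tk}$ ($t\le k$), $\phi^i_k$, satisfying $\theta^{ij}_t+\gamma^{ij}_{tk}+\phi^i_k\ge 0$ for $i\in I$, $j\in J$, $t\in T$, $k\in\{t,\ldots,NT\}$; $\theta^{ij}_t\ge 0$ for all $i,j,t$; $\gamma^{ij}_{tk}\ge 0$ for all $i,j$ and $t\le k$; and the normalization $\phi^i_t\ge -1$ for $i\in I$, $t\in T$. (The projected inequalities describe the projection onto the $(x,y)$-space of the facility location formulation of the multi-item inventory lot-sizing problem with supplier selection.) *)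

(* Defs.v *)
(* Items, suppliers and periods are 'I_NI, 'I_NJ and 'I_NT, so all
   indices are 0-based; period 1 of the usual numbering is index 0. *)
From mathcomp Require Import all_boot all_order all_algebra.

Set Implicit Arguments.
Unset Strict Implicit.
Unset Printing Implicit Defensive.

Import Order.TTheory GRing.Theory Num.Theory.
Local Open Scope ring_scope.

(* d^i_{kt}.  The bounds are naturals so that d^i_{1l} is
   [cum_demand d i 0 l] without having to exhibit a first period. *)
Definition cum_demand (R : realFieldType) (NI NT : nat)
    (d : 'I_NI -> 'I_NT -> R) (i : 'I_NI) (k t : nat) : R :=
  \sum_(u < NT | (k <= u <= t)%N) d i u.

(* gamma is a total function of (t, k), but only its components with t <= k
   are part of the vector: neither this predicate nor [projected_lhs]
   looks at the others. *)
Definition projection_vector (R : realFieldType) (NI NJ NT : nat)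
    (theta : 'I_NI -> 'I_NJ -> 'I_NT -> R)
    (gamma : 'I_NI -> 'I_NJ -> 'I_NT -> 'I_NT -> R)
    (phi : 'I_NI -> 'I_NT -> R) : Prop :=
  [/\ forall i j (t k : 'I_NT), (t <= k)%N ->
        0 <= theta i j t + gamma i j t k + phi i k,
      forall i j t, 0 <= theta i j t,
      forall i j (t k : 'I_NT), (t <= k)%N -> 0 <= gamma i j t k
    & forall i t, -1 <= phi i t].

(* The projected inequality is [0 <= projected_lhs d theta gamma phi x y]. *)
Definition projected_lhs (R : realFieldType) (NI NJ NT : nat)
    (d : 'I_NI -> 'I_NT -> R)
    (theta : 'I_NI -> 'I_NJ -> 'I_NT -> R)
    (gamma : 'I_NI -> 'I_NJ -> 'I_NT -> 'I_NT -> R)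
    (phi : 'I_NI -> 'I_NT -> R)
    (x : 'I_NI -> 'I_NJ -> 'I_NT -> R) (y : 'I_NJ -> 'I_NT -> R) : R :=
  \sum_(i < NI) \sum_(j < NJ) \sum_(t < NT) theta i j t * x i j t
  + \sum_(i < NI) \sum_(j < NJ) \sum_(t < NT) \sum_(k < NT | (t <= k)%N)
      gamma i j t k * d i k * y j t
  + \sum_(i < NI) \sum_(t < NT) phi i t * d i t.

Definition periods_upto (NT : nat) (l : 'I_NT) : {set 'I_NT} :=
  [set u : 'I_NT | (u <= l)%N].

(* The (l,S_j)-inequality for item i0 is
   [cum_demand d i0 0 l <= lS_lhs d i0 l S x y]. *)
Definition lS_lhs (R : realFieldType) (NI NJ NT : nat)
    (d : 'I_NI -> 'I_NT -> R) (i0 : 'I_NI) (l : 'I_NT)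
    (S : 'I_NJ -> {set 'I_NT})
    (x : 'I_NI -> 'I_NJ -> 'I_NT -> R) (y : 'I_NJ -> 'I_NT -> R) : R :=
  \sum_(j < NJ)
    (\sum_(u in periods_upto l :\: S j) x i0 j u
     + \sum_(u in S j) cum_demand d i0 u l * y j u).

(* Main.v *)
(* The witness is the indicator vector of item i0: theta marks the periods of
   L \ S_j, gamma the pairs (t, k) with t in S_j and k in L, and phi is -1 on L.
   For t <= k in L, exactly one of theta_t and gamma_tk is 1, which
   compensates phi_k = -1. *)
Require Import Defs.
From mathcomp Require Import all_boot all_order all_algebra.
Import Order.TTheory GRing.Theory Num.Theory.
Local Open Scope ring_scope.

(** Serves twice per sum: to turn the indicators in the witness into summation ranges, and, with
    [i == i0], to collapse the sum over items. *)
Lemma sum_indicator (R : pzSemiRingType) (I : finType) (P : pred I)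
    (F : I -> R) :
  \sum_i (P i)%:R * F i = \sum_(i | P i) F i.
Proof.
by rewrite [RHS]big_mkcond; apply: eq_bigr => i _; rewrite mulr_natl mulrb.
Qed.

Theorem theorem10 (R : realFieldType) (NI NJ NT : nat)
    (d : 'I_NI -> 'I_NT -> R) (hd : forall i t, 0 <= d i t)
    (i0 : 'I_NI) (l : 'I_NT) (S : 'I_NJ -> {set 'I_NT})
    (hS : forall j, S j \subset periods_upto l) :
  exists (theta : 'I_NI -> 'I_NJ -> 'I_NT -> R)
         (gamma : 'I_NI -> 'I_NJ -> 'I_NT -> 'I_NT -> R)
         (phi : 'I_NI -> 'I_NT -> R),
    projection_vector theta gamma phi /\
    forall (x : 'I_NI -> 'I_NJ -> 'I_NT -> R) (y : 'I_NJ -> 'I_NT -> R),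
      projected_lhs d theta gamma phi x y
      = lS_lhs d i0 l S x y - cum_demand d i0 0 l.
Proof.
exists (fun i j t => (i == i0)%:R * (t \in periods_upto l :\: S j)%:R).
exists (fun i j t k => (i == i0)%:R * ((t \in S j)%:R * (k <= l)%N%:R)).
exists (fun i k => (i == i0)%:R * - (k <= l)%N%:R).
split.
  split=> [i j t k le_tk|i j t|i j t k _|i t].
  - rewrite -!mulrDr mulr_ge0 ?ler0n // !inE.
    (* For [k > l] both gamma and phi vanish, leaving theta. Otherwise [t <= k <= l] puts t in L,
       hence in exactly one of [S j] and its complement in L. *)
    have [le_kl|_] := leqP k l; last first.
      by rewrite mulr0 oppr0 !addr0 ler0n.
    by rewrite (leq_trans le_tk le_kl); case: (t \in S j);
      rewrite /= mulr1 ?add0r ?addr0 subrr.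
  - by rewrite mulr_ge0 ?ler0n.
  - by rewrite !mulr_ge0 ?ler0n.
  - by case: (i == i0); case: (t <= l)%N;
      rewrite ?mul1r ?mul0r ?oppr0 ?lerN10.
move=> x y; rewrite /projected_lhs /lS_lhs /cum_demand big_split /=.
(* The x-terms, the y-terms and the constant are matched separately. *)
congr (_ + _ + _).
- transitivity (\sum_i (i == i0)%:R *
      \sum_j \sum_(t in periods_upto l :\: S j) x i j t).
    apply: eq_bigr => i _; rewrite mulr_sumr; apply: eq_bigr => j _.
    rewrite mulr_sumr -[RHS]sum_indicator.
    by apply: eq_bigr => t _; rewrite mulrCA mulrA.
  by rewrite sum_indicator big_pred1_eq.
(* The cutoff [k <= l] in gamma truncates the demands from t onwards to exactly $d^i_{tl}$, the
   coefficient of [y j t]. *)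
- transitivity (\sum_i (i == i0)%:R * \sum_j \sum_(t in S j)
      (\sum_(k < NT | (t <= k <= l)%N) d i k) * y j t).
    apply: eq_bigr => i _; rewrite mulr_sumr; apply: eq_bigr => j _.
    rewrite mulr_sumr -[RHS]sum_indicator; apply: eq_bigr => t _.
    rewrite big_mkcondr /= mulr_suml !mulr_sumr; apply: eq_bigr => k _.
    by case: (k <= l)%N; [rewrite mulr1 mulrCA !mulrA|rewrite !(mulr0, mul0r)].
  by rewrite sum_indicator big_pred1_eq.
(* The lower bound [0 <= k] in [cum_demand d i0 0 l] is true by computation, so only [k <= l] is
   kept. *)
- transitivity (\sum_i (i == i0)%:R * - \sum_(k < NT | (k <= l)%N) d i k).
    apply: eq_bigr => i _.
    rewrite -(sum_indicator _ _ (fun k : 'I_NT => (k <= l)%N)) -sumrN mulr_sumr.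
    by apply: eq_bigr => k _; rewrite -mulrA mulNr.
  by rewrite sum_indicator big_pred1_eq.
Qed.
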